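(* Let $\mathcal H$ and $\hat{\mathcal H}$ be compact self-adjoint operators with non-negative eigenvalues on a separable real Hilbert space $\mathbb H$, and let $J=\{j\}$ be a single index with spectral gap $\gamma_J>0$ (all notation as defined in the context). If $\hat\alpha_J\le1/4$ and $\langle\hat\psi_j,\psi_j\rangle\ge0$, then $$\Big\|\hat\psi_j-\psi_j-\sum_{m\ne j}\frac{\langle(\hat{\mathcal H}-\mathcal H)\psi_j,\psi_m\rangle}{\lambda_j-\lambda_m}\psi_m\Big\|\le\frac{164}{9}\,\hat\alpha_J\hat\beta_J .$$
   Context: $\mathbb H$ is a separable real Hilbert space with inner product $\langle\cdot,\cdot\rangle$ and norm $\|\cdot\|$; $\|\cdot\|_{\mathrm{op}}$ and $\|\cdot\|_{\mathrm{HS}}$ are the operator and Hilbert–Schmidt norms; $(u\otimes v)w=\langle v,w\rangle u$. $\mathcal H,\hat{\mathcal H}$ are compact self-adjoint operators on $\mathbb H$ whose eigenvalues are all non-negative. Write $\mathcal H=\sum_{k}\lambda_k\mathcal Q_k$, $\mathcal Q_k=\psi_k\otimes\psi_k$, with $\lambda_1\ge\lambda_2\ge\dots\ge0$ (repeated according to multiplicity) and orthonormal eigenvectors $\psi_k$; similarly $\hat{\mathcal H}=\sum_k\hat\lambda_k\hat{\mathcal Q}_k$, $\hat{\mathcal Q}_k=\hat\psi_k\otimes\hat\psi_k$, $\hat\lambda_1\ge\hat\lambda_2\ge\dots\ge0$. Both eigenvector systems are understood to be complete, $\sum_k\mathcal Q_k=\sum_k\hat{\mathcal Q}_k=$ identity: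 if the ordered sequence misses part of the kernel, an orthonormal basis of the remaining part of the kernel is adjoined with eigenvalue $0$, and is included in all sums over indices not in $J$. For $J=\{j\}$: $\gamma_J:=\min_{\ell\ne j}|\lambda_j-\lambda_\ell|>0$, $\mathcal P_J=\mathcal Q_j$, $$|\mathcal R|_J^{1/2}=\sum_{k\ne j}\frac{\mathcal Q_k}{\sqrt{|\lambda_k-\lambda_j|}},\qquad \mathcal T_J^{1/2}=\frac{1}{\sqrt{\gamma_J}}\mathcal P_J+|\mathcal R|_J^{1/2},$$ $\hat\alpha_J=\|\mathcal T_J^{1/2}(\hat{\mathcal H}-\mathcal H)\mathcal T_J^{1/2}\|_{\mathrm{op}}$ and $\hat\beta_J=\gamma_J^{-1/2}\||\mathcal R|_J^{1/2}(\hat{\mathcal H}-\mathcal H)\mathcal P_J\|_{\mathrm{HS}}$. *)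

(* Defs.v *)
From HB Require Import structures.
From mathcomp Require Import all_boot all_order all_algebra.
From mathcomp Require Import all_classical all_reals all_analysis.
From mathcomp Require Import finmap.
From mathcomp Require analysis.showcase.summability.

Set Implicit Arguments.
Unset Strict Implicit.
Unset Printing Implicit Defensive.

Import Order.TTheory GRing.Theory Num.Theory.
Import numFieldNormedType.Exports.

Local Open Scope classical_set_scope.
Local Open Scope ring_scope.

Section Sums.
Context {R : realType} {V : normedModType R} {I : choiceType}.
Implicit Types (A : set I) (f : I -> V).

Definition psum A f : {fset I} -> V :=
  summability.partial_sum (fun i => if i \in A then f i else 0).

(* Norm convergence of the net of finite partial sums, so that no enumeration
   of A is involved. *)
Definition sums_to A f (v : V) : Prop :=
  psum A f F @[F --> summability.totally] --> v.

(* Has its intended meaning only when the net converges, which is the case for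
   all sums below: their terms are orthogonal with square-summable norms. *)
Definition vsum A f : V := lim (psum A f F @[F --> summability.totally]).

End Sums.

Definition separable (W : topologicalType) : Prop :=
  exists2 S : set W, countable S & dense S.

Section Operators.
Context {R : realType} {V : completeNormedModType R}.
Variable dot : {dot V for @idfun R}.
Implicit Types T : V -> V.

(* A Hilbert space is a complete normed module whose norm is the one of [dot]. *)
Definition norm_of_dot : Prop := forall x : V, `|x| = Num.sqrt (dot x x).

Definition compact_operator T : Prop :=
  precompact (T @` [set x | `|x| <= 1]).

Definition self_adjoint T : Prop := forall u v, dot (T u) v = dot u (T v).

Definition nonneg_eigenvalues T : Prop :=
  forall (a : R) (v : V), v != 0 -> T v = a *: v -> 0 <= a.

Definition tensor (u v : V) : V -> V := fun w => dot v w *: u.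

Definition opnorm T : \bar R :=
  ereal_sup [set `|T x|%:E | x in [set x | `|x| <= 1]].

(* A maximal orthonormal set. *)
Definition orthonormal_basis (B : set V) : Prop :=
  (forall e f, B e -> B f -> dot e f = (e == f)%:R) /\
  (forall x, (forall e, B e -> dot e x = 0) -> x = 0).

(* The Hilbert-Schmidt sum has the same value in every orthonormal basis; the
   supremum over all bases avoids choosing one. *)
Definition hsnorm T : \bar R :=
  ereal_sup [set sqrte (\esum_(e in B) (`|T e| ^+ 2)%:E)
            | B in orthonormal_basis].

End Operators.

(* [inl k] is the position k (counted from 0) in the ordered sequence of
   eigenvalues, [inr k] labels a kernel vector adjoined to complete it. *)
Notation eigen_index := (nat + nat)%type.

Section Eigensystem.
Context {R : realType} {V : completeNormedModType R}.
Variable dot : {dot V for @idfun R}.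

(* [eigval i] and [eigvec i] are meaningful for [i] in [eigidx] only: the ordered
   sequence and the adjoined family may each be finite or infinite. *)
Record eigensystem (H : V -> V) := Eigensystem {
  eigidx : set eigen_index ;
  eigval : eigen_index -> R ;
  eigvec : eigen_index -> V ;
  eigidx_initial : forall k, eigidx (inl k.+1) -> eigidx (inl k) ;
  eigval_ordered : forall k, eigidx (inl k.+1) ->
    eigval (inl k.+1) <= eigval (inl k) ;
  eigval_ge0 : forall i, eigidx i -> 0 <= eigval i ;
  eigval_adjoined : forall k, eigidx (inr k) -> eigval (inr k) = 0 ;
  eigvec_orthonormal : forall i i', eigidx i -> eigidx i' ->
    dot (eigvec i) (eigvec i') = (i == i')%:R ;
  eigvecP : forall i, eigidx i -> H (eigvec i) = eigval i *: eigvec i ;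
  spectral_decomposition : forall v,
    sums_to eigidx
      (fun k => eigval k *: tensor dot (eigvec k) (eigvec k) v) (H v) ;
  eigvec_complete : forall v,
    sums_to eigidx (fun k => tensor dot (eigvec k) (eigvec k) v) v
}.

Section Perturbation.
Variables (H Hhat : V -> V) (S : eigensystem H) (j : nat).

Local Notation J := (inl j).
Local Notation lam := (eigval S).
Local Notation psi := (eigvec S).
Local Notation Q k := (tensor dot (psi k) (psi k)).

Definition off_diag : set eigen_index := eigidx S `\ J.

(* The infimum is a minimum when there is a second index: by monotonicity it is
   attained at a neighbour of j in the ordered sequence or at an adjoined index. *)
Definition gap : R := inf [set `|lam J - lam l| | l in off_diag].

Definition projJ : V -> V := Q J.

Definition sqrt_absR (v : V) : V :=
  vsum off_diag (fun k => (Num.sqrt `|lam k - lam J|)^-1 *: Q k v).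

Definition sqrt_T (v : V) : V :=
  (Num.sqrt gap)^-1 *: projJ v + sqrt_absR v.

Definition pert : V -> V := Hhat \- H.

Definition alpha : \bar R := opnorm (sqrt_T \o pert \o sqrt_T).

Definition beta : \bar R :=
  (((Num.sqrt gap)^-1)%:E * hsnorm dot (sqrt_absR \o pert \o projJ))%E.

Definition first_order : V :=
  vsum off_diag (fun m =>
    (dot (pert (psi J)) (psi m) / (lam J - lam m)) *: psi m).

End Perturbation.
End Eigensystem.

(* Main.v *)
Require Import Defs.
From HB Require Import structures.
From mathcomp Require Import all_boot all_order all_algebra.
From mathcomp Require Import all_classical all_reals all_analysis.
From mathcomp Require Import finmap ring lra.

Set Implicit Arguments.
Unset Strict Implicit.
Unset Printing Implicit Defensive.

Import Order.TTheory GRing.Theory Num.Theory.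
Import numFieldNormedType.Exports.

Local Open Scope classical_set_scope.
Local Open Scope ring_scope.

(** Write u_k = <psi_k, u>, E = Hhat - H, rho_k = sqrt |lambda_k - lambda_j|
    for k <> j and rho_j = sqrt gamma with gamma the gap.  Then T^{1/2} is the
    diagonal operator with entries 1/rho_k; as the eigenvalues of H are bounded,
    it has a bounded inverse L, diagonal with entries rho_k, and the definition
    of alpha says that |T^{1/2} E u| <= alpha |L u| for all u
    ([alpha_fin]), so that E is small relative to L.  All comparisons are made
    coordinate by coordinate, by [dot_le] and [norm_le].

    Eigenvalue.  By [form_bound], |<E u, u>| <= alpha <L^2 u, u>, so Hhat lies
    between H - alpha L^2 and H + alpha L^2.  Subtracting alpha L^2 moves the
    eigenvalues above lambda_j towards it by the fraction alpha <= 1 of their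
    distance, so they do not cross it, and lambda_j itself moves by
    alpha gamma; likewise for the eigenvalues below when alpha L^2 is added.
    The min-max argument (a nonzero combination of j + 1 eigenvectors of one
    operator that is orthogonal to the first j eigenvectors of the other) then
    gives |lambdahat_j - lambda_j| <= alpha gamma ([eigval_pert_ge],
    [eigval_pert_le]), hence |lambdahat_j - lambda_k| >= 3/4 rho_k^2 for k <> j,
    as alpha <= 1/4.

    Eigenvector ([remainder_le]).  Write psihat_j = t psi_j + w with
    w orthogonal to psi_j, and put x = |R|^{1/2} E psi_j, y = |R|^{1/2} E w,
    b = gamma^{-1/2} |x| <= beta ([beta_ge]).  The eigenvalue equation reads
    (lambdahat_j - lambda_k) w_k = t (E psi_j)_k + (E w)_k.  Dividing by rho_k,
    |L w| <= 4/3 (|x| + |y|) with |y| <= alpha |L w|; since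
    alpha <= 1/4 this self-bounding inequality gives |L w| <= 2 |x|, so
    |w| <= 2 b, while b <= alpha.  Subtracting the first-order term f leaves
    (lambda_j - lambda_k) (w - f)_k
      = (t - 1) (E psi_j)_k + (E w)_k - (lambdahat_j - lambda_j) w_k,
    three terms that are each quadratically small: 1 - t <= 1 - t^2 = |w|^2
    thanks to the sign condition, |y| <= 2 alpha |x|, and the eigenvalue shift
    is at most alpha gamma.  Together |w - f| <= 5 alpha b, and the component
    along psi_j is at most |w|^2 <= 4 alpha b, so the remainder is at most
    9 alpha b. *)

#[local] Existing Instance summability.totally_filter.

(** * Real inner products *)

Section InnerProduct.
Context {R : realType} {V : completeNormedModType R}.
Variable dot : {dot V for @idfun R}.
Implicit Types u v w : V.

Lemma dotC u v : dot u v = dot v u.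
Proof. by rewrite hermC expr0 mul1r. Qed.

Lemma dotDl u v w : dot (u + v) w = dot u w + dot v w.
Proof. exact: linearDl. Qed.

Lemma dotDr u v w : dot w (u + v) = dot w u + dot w v.
Proof. exact: linearDr. Qed.

Lemma dotNr u v : dot u (- v) = - dot u v.
Proof. exact: linearNr. Qed.

Lemma dotBr u v w : dot w (u - v) = dot w u - dot w v.
Proof. by rewrite dotDr dotNr. Qed.

Lemma dotBl u v w : dot (u - v) w = dot u w - dot v w.
Proof. by rewrite !(dotC _ w) dotBr. Qed.

Lemma dotZr a u v : dot u (a *: v) = a * dot u v.
Proof. exact: linearZr_LR. Qed.

Lemma dotZl a u v : dot (a *: u) v = a * dot u v.
Proof. by rewrite dotC dotZr dotC. Qed.

Lemma dot0r u : dot u 0 = 0.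
Proof. exact: linear0r. Qed.

Lemma dot_sumr (I : Type) (r : seq I) (P : pred I) (F : I -> V) u :
  dot u (\sum_(i <- r | P i) F i) = \sum_(i <- r | P i) dot u (F i).
Proof. exact: linear_sumr. Qed.

Lemma dot_ge0 u : 0 <= dot u u.
Proof.
have [->|u0] := eqVneq u 0; first by rewrite dot0r.
exact/ltW/neq0_dnorm_gt0.
Qed.

Hypothesis ndot : norm_of_dot dot.

Lemma dotxx u : dot u u = `|u| ^+ 2.
Proof. by rewrite ndot sqr_sqrtr // dot_ge0. Qed.

Lemma dot_le_norm u v : `|dot u v| <= `|u| * `|v|.
Proof.
have [->|v0] := eqVneq v 0; first by rewrite dot0r !normr0 mulr0.
have nv : 0 < `|v| ^+ 2 by rewrite exprn_gt0 // normr_gt0.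
have := dot_ge0 (`|v| ^+ 2 *: u - dot u v *: v).
rewrite dotBl !dotBr !dotZl !dotZr (dotC v u) !dotxx => h.
have : (dot u v) ^+ 2 <= (`|u| * `|v|) ^+ 2.
  rewrite -(ler_pM2l nv) -subr_ge0.
  by move: h; congr (is_true (0 <= _)); ring.
by rewrite -(real_normK (num_real (dot u v))) ler_sqr ?nnegrE ?mulr_ge0.
Qed.

End InnerProduct.

(** * Coordinates in a complete orthonormal family *)

Section Coordinates.
Context {R : realType} {V : completeNormedModType R}.
Variable dot : {dot V for @idfun R}.
Hypothesis ndot : norm_of_dot dot.
Context {I : choiceType} (A : set I) (e : I -> V).
Hypothesis e_orthonormal :
  forall i i', A i -> A i' -> dot (e i) (e i') = (i == i')%:R.
Hypothesis e_complete :
  forall v, sums_to A (fun k => tensor dot (e k) (e k) v) v.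
Implicit Types (u v : V) (B : set I) (F : {fset I}) (c : I -> R) (C : R).

Lemma psumE {W : normedModType R} B (f : I -> W) F :
  psum B f F = \sum_(i <- F) (if i \in B then f i else 0).
Proof. by rewrite [RHS]big_seq_fsetE. Qed.

(** Parseval, for pairs: the partial expansions of u converge in norm and the
    inner product with v is continuous. *)
Lemma cvg_dot u v :
  psum A (fun i => dot (e i) u * dot (e i) v) F @[F --> summability.totally]
    --> dot u v.
Proof.
apply/cvgrPdist_le => /= eps eps0.
have v1 : 0 < `|v| + 1 by rewrite ltr_wpDl.
have := @e_complete u => /cvgrPdist_le /(_ (eps / (`|v| + 1))).
rewrite divr_gt0 // => /(_ isT); apply: filterS => F uF.
have -> : psum A (fun i => dot (e i) u * dot (e i) v) F
        = dot (psum A (fun k => tensor dot (e k) (e k) u) F) v.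
  rewrite !psumE [RHS](dotC dot) dot_sumr; apply: eq_bigr => i _.
  by case: ifP => _; rewrite ?dot0r // /tensor dotZr (dotC dot v).
rewrite -dotBl; apply: (le_trans (dot_le_norm ndot _ _)).
apply: (@le_trans _ _ (eps / (`|v| + 1) * `|v|)); first exact: ler_wpM2r.
rewrite -mulrA ler_piMr ?(ltW eps0) // mulrC ler_pdivrMr // mul1r.
by rewrite lerDl.
Qed.

(** Carries every estimate below: inequalities between the terms of two
    convergent coordinate sums pass to the inner products themselves. *)
Lemma dot_le u v u' v' :
  (forall k, A k ->
     dot (e k) u * dot (e k) v <= dot (e k) u' * dot (e k) v') ->
  dot u v <= dot u' v'.
Proof.
move=> h; rewrite -subr_ge0.
apply: cvgr_to_ge (cvgB (@cvg_dot u' v') (@cvg_dot u v)) _.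
apply: nearW => F; rewrite subr_ge0 !psumE; apply: ler_sum => i _.
by case: ifPn => // /set_mem; exact: h.
Qed.

Lemma dot_eq u v u' v' :
  (forall k, A k ->
     dot (e k) u * dot (e k) v = dot (e k) u' * dot (e k) v') ->
  dot u v = dot u' v'.
Proof. by move=> h; apply/le_anti/andP; split; apply: dot_le => k /h ->. Qed.

Lemma norm_le C u v : 0 <= C ->
  (forall k, A k -> `|dot (e k) u| <= C * `|dot (e k) v|) -> `|u| <= C * `|v|.
Proof.
move=> C0 h; rewrite -ler_sqr ?nnegrE ?mulr_ge0 // exprMn -!(dotxx ndot).
apply: (@le_trans _ _ (dot (C *: v) (C *: v))); last first.
  by rewrite !dotZl !dotZr mulrA -expr2.
apply: dot_le => k Ak; rewrite !dotZr -!expr2.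
rewrite -(real_normK (num_real (dot (e k) u))).
rewrite -(real_normK (num_real (C * _))) ler_sqr ?nnegrE //.
by rewrite normrM (ger0_norm C0) h.
Qed.

Lemma coord_inj u v : (forall k, A k -> dot (e k) u = dot (e k) v) -> u = v.
Proof.
move=> h; apply/eqP; rewrite -subr_eq0 -normr_le0 -(mul0r `|0 : V|).
by apply: norm_le => // k Ak; rewrite dotBr h // subrr normr0 mul0r.
Qed.

Lemma coord_psum B c v F k : B `<=` A -> A k ->
  dot (e k) (psum B (fun i => c i *: tensor dot (e i) (e i) v) F) =
  if (k \in F) && (k \in B) then c k * dot (e k) v else 0.
Proof.
move=> BA Ak; rewrite psumE dot_sumr.
have E i : dot (e k) (if i \in B then c i *: tensor dot (e i) (e i) v else 0)
    = if i == k then (if k \in B then c k * dot (e k) v else 0) else 0.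
  case: ifPn => [/set_mem Bi|iB].
    rewrite /tensor !dotZr e_orthonormal //; last exact: BA.
    rewrite (eq_sym k); case: eqVneq => [<-|_]; last by rewrite !mulr0.
    by rewrite mulr1 (mem_set Bi).
  by rewrite dot0r; case: eqVneq iB => // -> /negPf ->.
rewrite (eq_bigr _ (fun i _ => E i)).
have [kF|kF] /= := boolP (k \in F); last first.
  rewrite big_seq big1 // => i iF; case: eqP => // ik.
  by rewrite -ik iF in kF.
rewrite (bigD1_seq k) ?fset_uniq //= eqxx big1 ?addr0 // => i.
by move=> /negPf ->.
Qed.

(** Two partial sums of the multiplied expansion differ by at most C times the
    difference of the corresponding partial sums of v, coordinate by coordinate,
    so the net inherits the Cauchy property. *)
Lemma cvg_diag B c C v : B `<=` A -> 0 <= C -> (forall k, B k -> `|c k| <= C) ->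
  cvg (psum B (fun i => c i *: tensor dot (e i) (e i) v) F
         @[F --> summability.totally]).
Proof.
move=> BA C0 cC; apply/cauchy_cvgP/cauchy_exP => eps eps0.
have C1 : 0 < C + 1 by rewrite ltr_wpDl.
pose d := eps / (2 * (C + 1)).
have d0 : 0 < d by rewrite divr_gt0 // mulr_gt0.
have [F0 _ hF0] : summability.totally
    (fun F => `|v - psum A (fun k => tensor dot (e k) (e k) v) F| <= d).
  by have := @e_complete v => /cvgrPdist_le /(_ _ d0).
exists (psum B (fun i => c i *: tensor dot (e i) (e i) v) F0).
exists F0 => // F /= F0F; rewrite -ball_normE /ball_ /=.
set s := psum B _; set p := psum A (fun k => tensor dot (e k) (e k) v) in hF0.
have pE G k : A k -> dot (e k) (p G) = if k \in G then dot (e k) v else 0.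
  move=> Ak.
  have -> : p = psum A (fun i => 1 *: tensor dot (e i) (e i) v).
    by congr (psum A _); apply/funext => i; rewrite scale1r.
  by rewrite coord_psum // mul1r (mem_set Ak) andbT.
have sp : `|s F0 - s F| <= C * `|p F0 - p F|.
  apply: norm_le => // k Ak; rewrite !dotBr !pE // !coord_psum //.
  have [/set_mem kB|_] := boolP (k \in B); last first.
    by rewrite !andbF subrr normr0 mulr_ge0.
  rewrite !andbT; case: ifP => _; case: ifP => _;
    rewrite ?subrr ?subr0 ?sub0r ?normrN ?normr0 ?mulr0 // normrM ler_wpM2r //;
    exact: cC.
apply: (le_lt_trans sp).
have h : `|p F0 - p F| <= d + d.
  have -> : p F0 - p F = (v - p F) - (v - p F0).
    by rewrite opprB [RHS]addrC addrA subrK.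
  apply: (le_trans (ler_normB _ _)); apply: lerD; first exact: hF0.
  by apply: hF0 => /=; exact: fsubset_refl.
apply: (le_lt_trans (ler_wpM2l C0 h)).
have -> : eps = (C + 1) * (d + d) by rewrite /d; field; rewrite gt_eqF.
by rewrite ltr_pM2r ?addr_gt0 // ltrDl.
Qed.

(** The k-th coordinate of the partial sums is constant on every finite set
    that contains k, hence equal to its value in the limit. *)
Lemma coord_vsum B c C v k : B `<=` A -> 0 <= C ->
  (forall k, B k -> `|c k| <= C) -> A k ->
  dot (e k) (vsum B (fun i => c i *: tensor dot (e i) (e i) v)) =
  if k \in B then c k * dot (e k) v else 0.
Proof.
move=> BA C0 cC Ak; set x := RHS.
have cv : psum B (fun i => c i *: tensor dot (e i) (e i) v) F
    @[F --> summability.totally]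
    --> vsum B (fun i => c i *: tensor dot (e i) (e i) v).
  exact: (@cvg_diag B c C v BA C0 cC).
apply/eqP; rewrite -subr_eq0 -normr_le0; apply/ler_addgt0Pl => eps eps0.
rewrite addr0.
have ek : `|e k| = 1 by rewrite ndot e_orthonormal // eqxx sqrtr1.
have [F0 _ hF0] : summability.totally (fun F => `|vsum B
    (fun i => c i *: tensor dot (e i) (e i) v) -
  psum B (fun i => c i *: tensor dot (e i) (e i) v) F| <= eps).
  by move/cvgrPdist_le: cv; apply.
have /hF0 : ([set F | fsubset F0 F]) (fsetU F0 (fset1 k)).
  exact: fsubsetUl.
apply: le_trans.
have -> : x = dot (e k) (psum B (fun i => c i *: tensor dot (e i) (e i) v)
    (fsetU F0 (fset1 k))).
  by rewrite coord_psum // inE /= inE eqxx orbT.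
by rewrite -dotBr; apply: (le_trans (dot_le_norm ndot _ _)); rewrite ek mul1r.
Qed.

End Coordinates.

(** * Eigensystems and the min-max argument *)

Section MinMax.
Context {R : realType} {V : completeNormedModType R}.
Variable dot : {dot V for @idfun R}.

(** The nonzero u is a combination of e 0, ..., e n, and the n conditions on
    its n + 1 coefficients leave a nonzero kernel; being in the span is recorded
    in the dual form that is used, orthogonality to whatever is orthogonal to
    the e i. *)
Lemma exists_orthogonal_combination n (e f : nat -> V) :
  (forall i i', (i <= n)%N -> (i' <= n)%N -> dot (e i) (e i') = (i == i')%:R) ->
  exists2 u, u != 0 &
    (forall l, (l < n)%N -> dot (f l) u = 0) /\
    (forall v, (forall i, (i <= n)%N -> dot (e i) v = 0) -> dot v u = 0).
Proof.
move=> e_on; pose M := \matrix_(i < n.+1, l < n) dot (f l) (e i).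
have : kermx M != 0.
  by rewrite -mxrank_eq0 mxrank_ker subn_eq0 -ltnNge ltnS rank_leq_col.
case/rowV0Pn => c /sub_kermxP cM c0.
pose u := \sum_(i < n.+1) c 0 i *: e i; exists u; last split.
- apply: contraNneq c0 => u0; apply/eqP/rowP => i; rewrite mxE.
  have : dot (e i) u = 0 by rewrite u0 dot0r.
  rewrite dot_sumr (bigD1 i) //= dotZr e_on ?leq_ord // eqxx mulr1.
  rewrite big1 ?addr0 // => i' ii'.
  have /negPf ne : (i : nat) != i' by rewrite eq_sym.
  by rewrite dotZr e_on ?leq_ord // ne mulr0.
- move=> l ln; have /rowP/(_ (Ordinal ln)) := cM; rewrite !mxE => <-.
  by rewrite dot_sumr; apply: eq_bigr => i _; rewrite dotZr mxE.
- move=> v ev; rewrite dot_sumr big1 // => i _.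
  by rewrite dotZr dotC ev ?leq_ord // mulr0.
Qed.

End MinMax.

Section Eigensystem.
Context {R : realType} {V : completeNormedModType R}.
Variable dot : {dot V for @idfun R}.
Context {H : V -> V} (S : eigensystem dot H).

Lemma eigidx_le k l : (k <= l)%N -> eigidx S (inl l) -> eigidx S (inl k).
Proof.
move=> /subnK <-; elim: (l - k)%N => // n IH.
by rewrite addSn => /eigidx_initial.
Qed.

Lemma eigval_le k l : (k <= l)%N -> eigidx S (inl l) ->
  eigval S (inl l) <= eigval S (inl k).
Proof.
move=> /subnK <-; elim: (l - k)%N => // n IH.
rewrite addSn => Sl; apply: le_trans (IH (eigidx_initial Sl)).
exact: eigval_ordered.
Qed.

(** The adjoined indices carry the eigenvalue 0, so they rank after every index
    of the ordered sequence. *)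
Lemma eigval_le_tail j k : eigidx S (inl j) -> eigidx S k ->
  (forall l, (l < j)%N -> k != inl l) -> eigval S k <= eigval S (inl j).
Proof.
move=> Sj; case: k => [l Sl h|k Sk _]; last first.
  by rewrite eigval_adjoined //; exact: eigval_ge0.
by apply: eigval_le => //; rewrite leqNgt; apply/negP => /h; rewrite eqxx.
Qed.

Lemma eigval_le0 k : eigidx S (inl 0) -> eigidx S k ->
  eigval S k <= eigval S (inl 0).
Proof. by move=> S0 Sk; exact: eigval_le_tail. Qed.

Lemma coord_eigen : self_adjoint dot H -> forall k u, eigidx S k ->
  dot (eigvec S k) (H u) = eigval S k * dot (eigvec S k) u.
Proof. by move=> sH k u Sk; rewrite -sH eigvecP // dotZl. Qed.

Hypothesis ndot : norm_of_dot dot.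

Lemma form_le_tail j u : self_adjoint dot H -> eigidx S (inl j) ->
  (forall l, (l < j)%N -> dot (eigvec S (inl l)) u = 0) ->
  dot (H u) u <= eigval S (inl j) * dot u u.
Proof.
move=> sH Sj u0; rewrite -dotZl.
apply: (dot_le ndot (@eigvec_complete _ _ _ _ S)) => k Sk.
rewrite coord_eigen // dotZr -!mulrA -expr2.
case: (pselect (exists2 l, (l < j)%N & k = inl l)) => [[l lj ->]|nk].
  by rewrite u0 // expr0n !mulr0.
rewrite ler_wpM2r ?sqr_ge0 //; apply: eigval_le_tail => // l lj.
by apply/eqP => kl; apply: nk; exists l.
Qed.

Lemma form_ge_head j u : self_adjoint dot H -> eigidx S (inl j) ->
  (forall k, eigidx S k -> (forall l, (l <= j)%N -> k != inl l) ->
     dot (eigvec S k) u = 0) ->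
  eigval S (inl j) * dot u u <= dot (H u) u.
Proof.
move=> sH Sj u0; rewrite -dotZl.
apply: (dot_le ndot (@eigvec_complete _ _ _ _ S)) => k Sk.
rewrite coord_eigen // dotZr -!mulrA -expr2.
case: (pselect (exists2 l, (l <= j)%N & k = inl l)) => [[l lj ->]|nk].
  by rewrite ler_wpM2r ?sqr_ge0 // eigval_le.
rewrite u0 ?expr0n ?mulr0 // => l lj.
by apply/eqP => kl; apply: nk; exists l.
Qed.

Lemma eigvec_norm k : eigidx S k -> `|eigvec S k| = 1.
Proof. by move=> Sk; rewrite ndot eigvec_orthonormal // eqxx sqrtr1. Qed.

(** The Hilbert-Schmidt norm is a supremum over orthonormal bases; this basis is
    the one that gives the lower bound of [beta_ge]. *)
Lemma eigvec_basis : orthonormal_basis dot (eigvec S @` eigidx S).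
Proof.
split=> [_ _ [k Sk <-] [l Sl <-]|x xS].
  rewrite eigvec_orthonormal //; case: (eqVneq k l) => [->|kl].
    by rewrite eqxx.
  case: eqVneq => // ekl; have := eigvec_orthonormal Sk Sl.
  rewrite ekl eigvec_orthonormal // eqxx (negPf kl) => /eqP.
  by rewrite oner_eq0.
apply: (coord_inj ndot (@eigvec_complete _ _ _ _ S)).
by move=> k Sk; rewrite dot0r xS //; exists k.
Qed.

End Eigensystem.

(** * The weights of the perturbation problem *)

Section Perturbation.
Context {R : realType} {V : completeNormedModType R}.
Variable dot : {dot V for @idfun R}.
Variables (H Hhat : {linear V -> V}).
Variables (S : eigensystem dot H) (Shat : eigensystem dot Hhat) (j : nat).
Hypothesis ndot : norm_of_dot dot.
Hypothesis saH : self_adjoint dot H.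
Hypothesis saHhat : self_adjoint dot Hhat.
Hypothesis Sj : eigidx S (inl j).
Hypothesis Shatj : eigidx Shat (inl j).
Hypothesis gap_gt0 : 0 < gap S j.

Local Notation J := (inl j).
Local Notation lam := (eigval S).
Local Notation psi := (eigvec S).
Local Notation lamhat := (eigval Shat J).
Local Notation psihat := (eigvec Shat J).
Local Notation E := (pert H Hhat).
Local Notation coord k u := (dot (psi k) u).
Implicit Types (u v : V) (k : eigen_index).

Let on := @eigvec_orthonormal _ _ _ _ S.
Let cpl := @eigvec_complete _ _ _ _ S.

(** The reciprocals of the eigenvalues of [sqrt_T]. *)
Definition rho k : R := if k == J then Num.sqrt (gap S j)
  else Num.sqrt `|lam k - lam J|.

Definition inv_sqrt_T u : V :=
  vsum (eigidx S) (fun k => rho k *: tensor dot (psi k) (psi k) u).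

Local Notation L := inv_sqrt_T.

Lemma off_diagE k : eigidx S k -> (k \in off_diag S j) = (k != J).
Proof.
move=> Sk; apply/idP/idP => [/set_mem[_ /eqP]//|kJ].
by apply/mem_set; split=> //; exact/eqP.
Qed.

Lemma off_diag_sub : off_diag S j `<=` eigidx S.
Proof. by move=> k []. Qed.

Lemma gap_le k : eigidx S k -> k != J -> gap S j <= `|lam k - lam J|.
Proof.
move=> Sk kJ; rewrite distrC; apply: ge_inf; last first.
  by exists k => //; split=> //; exact/eqP.
by exists 0 => _ [l _ <-].
Qed.

Lemma sqr_rhoJ : rho J ^+ 2 = gap S j.
Proof. by rewrite /rho eqxx sqr_sqrtr // ltW. Qed.

Lemma sqr_rho k : k != J -> rho k ^+ 2 = `|lam k - lam J|.
Proof. by move=> /negPf kJ; rewrite /rho kJ sqr_sqrtr. Qed.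

Lemma rho_ge k : eigidx S k -> Num.sqrt (gap S j) <= rho k.
Proof.
move=> Sk; rewrite /rho; case: eqVneq => // kJ.
by rewrite ler_sqrt // gap_le.
Qed.

Lemma rho_gt0 k : eigidx S k -> 0 < rho k.
Proof. by move=> /rho_ge; apply: lt_le_trans; rewrite sqrtr_gt0. Qed.

Lemma rho_le k : eigidx S k ->
  `|rho k| <= Num.sqrt (gap S j) + Num.sqrt (lam (inl 0%N)).
Proof.
move=> Sk; rewrite (gtr0_norm (rho_gt0 Sk)) /rho.
have S0 := eigidx_le (leq0n j) Sj.
case: ifP => _; first by rewrite lerDl sqrtr_ge0.
apply: ler_wpDl; first exact: sqrtr_ge0.
rewrite ler_sqrt ?eigval_ge0 //.
have := eigval_le0 S0 Sk; have := eigval_le0 S0 Sj.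
have := eigval_ge0 Sk; have := eigval_ge0 Sj.
by rewrite ler_norml; lra.
Qed.

Lemma inv_rho_le k : eigidx S k -> `|(rho k)^-1| <= (Num.sqrt (gap S j))^-1.
Proof.
move=> Sk; rewrite normfV (gtr0_norm (rho_gt0 Sk)).
by rewrite lef_pV2 ?posrE ?rho_gt0 ?sqrtr_gt0 // rho_ge.
Qed.

Lemma coord_inv_sqrt_T u k : eigidx S k -> coord k (L u) = rho k * coord k u.
Proof.
move=> Sk; rewrite /L.
pose C := Num.sqrt (gap S j) + Num.sqrt (lam (inl 0%N)).
rewrite (coord_vsum ndot on cpl (C := C)) //.
- by rewrite mem_set.
- by rewrite addr_ge0.
- exact: rho_le.
Qed.

Lemma coord_sqrt_absR u k : eigidx S k ->
  coord k (sqrt_absR S j u) = if k == J then 0 else (rho k)^-1 * coord k u.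
Proof.
move=> Sk; rewrite /sqrt_absR.
rewrite (coord_vsum ndot on cpl (C := (Num.sqrt (gap S j))^-1)) //.
- by rewrite off_diagE //= /rho; case: eqP.
- exact: off_diag_sub.
- move=> l [Sl /eqP lJ]; have := inv_rho_le Sl.
  by rewrite /rho (negPf lJ).
Qed.

Lemma coord_sqrt_T u k : eigidx S k ->
  coord k (sqrt_T S j u) = (rho k)^-1 * coord k u.
Proof.
move=> Sk; rewrite /sqrt_T dotDr coord_sqrt_absR // /projJ /tensor !dotZr on //.
rewrite /rho; case: eqVneq => [->|_]; first by rewrite addr0 mulr1.
by rewrite !mulr0 add0r.
Qed.

Lemma coord_first_order k : eigidx S k ->
  coord k (first_order Hhat S j) =
  if k == J then 0 else coord k (E (psi J)) / (lam J - lam k).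
Proof.
move=> Sk; rewrite /first_order.
have -> : (fun m => (dot (E (psi J)) (psi m) / (lam J - lam m)) *: psi m) =
   (fun m => (lam J - lam m)^-1 *: tensor dot (psi m) (psi m) (E (psi J))).
  by apply/funext => m; rewrite /tensor scalerA mulrC (dotC dot (psi m)).
rewrite (coord_vsum ndot on cpl (C := (gap S j)^-1)) //.
- by rewrite off_diagE //; case: eqP => //= _; rewrite mulrC.
- exact: off_diag_sub.
- by rewrite invr_ge0 ltW.
- move=> l [Sl /eqP lJ]; rewrite normfV distrC.
  have := gap_le Sl lJ => h.
  by rewrite lef_pV2 ?posrE // (lt_le_trans gap_gt0).
Qed.

Lemma pertD u v : E (u + v) = E u + E v.
Proof. exact: linearD. Qed.

Lemma pertZ a u : E (a *: u) = a *: E u.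
Proof. exact: linearZZ. Qed.

Lemma sqrt_TZ a u : sqrt_T S j (a *: u) = a *: sqrt_T S j u.
Proof.
apply: (coord_inj ndot cpl) => k Sk.
by rewrite dotZr !coord_sqrt_T // dotZr mulrCA.
Qed.

Lemma sqrt_TK u : sqrt_T S j (L u) = u.
Proof.
apply: (coord_inj ndot cpl) => k Sk.
by rewrite coord_sqrt_T // coord_inv_sqrt_T // mulKf // gt_eqF // rho_gt0.
Qed.

Lemma sqrt_absR_le u : `|sqrt_absR S j u| <= `|sqrt_T S j u|.
Proof.
rewrite -[leRHS]mul1r; apply: (norm_le ndot cpl) => // k Sk.
rewrite mul1r coord_sqrt_absR // coord_sqrt_T //.
by case: ifP => // _; rewrite normr0.
Qed.

Lemma norm_inv_sqrt_T_psiJ : `|L (psi J)| = Num.sqrt (gap S j).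
Proof.
have -> : L (psi J) = Num.sqrt (gap S j) *: psi J.
  apply: (coord_inj ndot cpl) => k Sk.
  rewrite coord_inv_sqrt_T // dotZr on //; case: eqVneq => [->|]; last first.
    by rewrite !mulr0.
  by rewrite /rho eqxx.
by rewrite normrZ eigvec_norm // mulr1 ger0_norm ?sqrtr_ge0.
Qed.

Lemma norm_le_inv_sqrt_T u : Num.sqrt (gap S j) * `|u| <= `|L u|.
Proof.
have g0 : 0 < Num.sqrt (gap S j) by rewrite sqrtr_gt0.
rewrite mulrC -ler_pdivlMr // mulrC; apply: (norm_le ndot cpl).
  by rewrite invr_ge0 ltW.
move=> k Sk; rewrite coord_inv_sqrt_T // normrM (gtr0_norm (rho_gt0 Sk)) mulrA.
by rewrite ler_peMl // mulrC ler_pdivlMr // mul1r rho_ge.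
Qed.

Lemma norm_sqrt_absR u : Num.sqrt (gap S j) * `|sqrt_absR S j u| <= `|u|.
Proof.
have g0 : 0 < Num.sqrt (gap S j) by rewrite sqrtr_gt0.
rewrite mulrC -ler_pdivlMr // mulrC; apply: (norm_le ndot cpl).
  by rewrite invr_ge0 ltW.
move=> k Sk; rewrite coord_sqrt_absR //; case: ifP => _.
  by rewrite normr0 mulr_ge0 // invr_ge0 ltW.
by rewrite normrM ler_wpM2r // inv_rho_le.
Qed.

(** Every u is the image under [sqrt_T] of [inv_sqrt_T u], so the bound on
    sqrt_T E sqrt_T becomes a bound on sqrt_T E relative to [inv_sqrt_T]. *)
Lemma alpha_fin a0 : (alpha Hhat S j <= a0%:E)%E ->
  exists2 a : R, alpha Hhat S j = a%:E &
    [/\ 0 <= a, a <= a0 & forall u, `|sqrt_T S j (E u)| <= a * `|L u|].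
Proof.
move=> aq.
pose K := sqrt_T S j \o E \o sqrt_T S j.
have ub u : `|u| <= 1 -> (`|K u|%:E <= alpha Hhat S j)%E.
  by move=> u1; apply: ereal_sup_ubound; exists u.
have KZ a u : K (a *: u) = a *: K u by rewrite /K /= sqrt_TZ pertZ sqrt_TZ.
case: (alpha Hhat S j) aq ub => [a aq ub|//|_ ub]; last first.
  by have := ub 0; rewrite normr0 ler01 => /(_ isT).
exists a => //; split=> //.
  by have := ub 0; rewrite normr0 ler01 lee_fin => /(_ isT); apply: le_trans.
move=> u; have -> : sqrt_T S j (E u) = K (L u) by rewrite /K /= sqrt_TK.
have [->|Lu0] := eqVneq (L u) 0.
  have -> : K 0 = 0 by rewrite -[X in K X](scale0r (0 : V)) KZ scale0r.
  by rewrite !normr0 mulr0.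
have nLu : 0 < `|L u| by rewrite normr_gt0.
have := ub (`|L u|^-1 *: L u); rewrite normrZ normfV normr_id mulVf ?gt_eqF //.
rewrite lexx => /(_ isT).
by rewrite lee_fin KZ normrZ normfV normr_id mulrC ler_pdivrMr.
Qed.

(** The operator in [beta] has rank one and is carried by psi_j: in the basis of
    the psi_k the single term at psi_j is already its norm. *)
Lemma beta_ge :
  (((Num.sqrt (gap S j))^-1 * `|sqrt_absR S j (E (psi J))|)%:E
    <= beta Hhat S j)%E.
Proof.
rewrite /beta EFinM; apply: lee_wpmul2l.
  by rewrite lee_fin invr_ge0 sqrtr_ge0.
apply: le_trans (ereal_sup_ubound _); last first.
  by exists (psi @` eigidx S) => //; exact: eigvec_basis.
set T := _ \o _.
have TJ : sqrt_absR S j (E (psi J)) = T (psi J).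
  by rewrite /T /= /projJ /tensor on // eqxx scale1r.
rewrite TJ; apply: (@le_trans _ _ (sqrte (`|T (psi J)| ^+ 2)%:E)).
  by rewrite /= sqrtr_sqr normr_id.
have sum_ge : ((`|T (psi J)| ^+ 2)%:E
    <= \esum_(e in psi @` eigidx S) (`|T e| ^+ 2)%:E)%E.
  apply: esum_ge; exists [set psi J].
    by split; [exact: finite_set1|move=> _ ->; exists J].
  by rewrite fsbig_set1.
by rewrite lee_sqrt // (le_trans _ sum_ge) // lee_fin sqr_ge0.
Qed.

(** * Eigenvalue and eigenvector bounds *)

Section Bound.
Variable a : R.
Hypothesis a_ge0 : 0 <= a.
Hypothesis a_le : a <= 1 / 4.
Hypothesis alphaP : forall u, `|sqrt_T S j (E u)| <= a * `|L u|.

Let a_le1 : a <= 1.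
Proof. by apply: le_trans a_le _; lra. Qed.

(** Both [sqrt_T] and [inv_sqrt_T] are symmetric and inverse to each other, so
    <E u, u> = <sqrt_T E u, inv_sqrt_T u>, to which Cauchy-Schwarz applies. *)
Lemma form_bound u : `|dot (E u) u| <= a * dot (L (L u)) u.
Proof.
have -> : dot (E u) u = dot (sqrt_T S j (E u)) (L u).
  apply: (dot_eq ndot cpl) => k Sk.
  rewrite coord_sqrt_T // coord_inv_sqrt_T // mulrACA mulVf ?mul1r //.
  by rewrite gt_eqF ?rho_gt0.
have -> : dot (L (L u)) u = dot (L u) (L u).
  by apply: (dot_eq ndot cpl) => k Sk; rewrite !coord_inv_sqrt_T //; ring.
rewrite (dotxx ndot) expr2 mulrA.
by apply: (le_trans (dot_le_norm ndot _ _)); rewrite ler_wpM2r.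
Qed.

Lemma dot_Hhat u : dot (Hhat u) u = dot (H u) u + dot (E u) u.
Proof. by rewrite -dotDl /pert /= addrC subrK. Qed.

(** Test vector in the span of psi_0, ..., psi_j, orthogonal to the hat vectors
    of index less than j: there Hhat is at most lambdahat_j, and at least
    H - a L^2, whose eigenvalues lambda_k - a (lambda_k - lambda_j), k < j,
    stay above lambda_j as a <= 1. *)
Lemma eigval_pert_ge : lam J - a * gap S j <= lamhat.
Proof.
have [u u0 [uhat uspan]] := @exists_orthogonal_combination _ _ dot j
  (fun i => psi (inl i)) (fun l => eigvec Shat (inl l))
  (fun i i' (ij : (i <= j)%N) (ij' : (i' <= j)%N) =>
     on (eigidx_le ij Sj) (eigidx_le ij' Sj)).
have nu : 0 < dot u u by rewrite (dotxx ndot) exprn_gt0 // normr_gt0.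
rewrite -(ler_pM2r nu).
apply: le_trans (form_le_tail ndot saHhat Shatj uhat); rewrite dot_Hhat.
have := form_bound u; rewrite ler_norml => /andP[h _].
have h2 : dot ((lam J - a * gap S j) *: u) u <= dot (H u - a *: L (L u)) u.
  apply: (dot_le ndot cpl) => k Sk.
  rewrite dotBr !dotZr !coord_inv_sqrt_T // (coord_eigen saH) //.
  have -> : (lam k * coord k u - a * (rho k * (rho k * coord k u))) * coord k u
    = (lam k - a * rho k ^+ 2) * coord k u ^+ 2 by ring.
  rewrite -mulrA -expr2.
  case: (pselect (exists2 l, (l <= j)%N & k = inl l));
      first move=> [l lj kl]; last first.
    move=> nk.
    have -> : coord k u = 0.
      apply: uspan => i ij; rewrite (on (eigidx_le ij Sj) Sk).
      by case: eqP => // ik; case: nk; exists i.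
    by rewrite expr0n !mulr0.
  rewrite ler_wpM2r ?sqr_ge0 //; have [->|kJ] := eqVneq k J.
    by rewrite sqr_rhoJ.
  have := eigval_le lj Sj; rewrite -kl => lk.
  rewrite sqr_rho // ger0_norm ?subr_ge0 //.
  have : 0 <= a * gap S j by rewrite mulr_ge0 // ltW.
  have : a * (lam k - lam J) <= 1 * (lam k - lam J).
    by rewrite ler_wpM2r ?subr_ge0.
  lra.
rewrite dotBl !dotZl in h2; lra.
Qed.

(** The same with the roles exchanged: a test vector in the span of the hat
    vectors of index at most j, orthogonal to psi_0, ..., psi_{j-1}. *)
Lemma eigval_pert_le : lamhat <= lam J + a * gap S j.
Proof.
have [u u0 [upsi uspan]] := @exists_orthogonal_combination _ _ dot j
  (fun i => eigvec Shat (inl i)) (fun l => psi (inl l))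
  (fun i i' (ij : (i <= j)%N) (ij' : (i' <= j)%N) =>
     eigvec_orthonormal (eigidx_le ij Shatj) (eigidx_le ij' Shatj)).
have nu : 0 < dot u u by rewrite (dotxx ndot) exprn_gt0 // normr_gt0.
rewrite -(ler_pM2r nu).
apply: le_trans (form_ge_head ndot saHhat Shatj _) _.
  move=> k Sk nk; apply: uspan => i ij.
  rewrite (eigvec_orthonormal (eigidx_le ij Shatj) Sk).
  by rewrite eq_sym (negPf (nk _ ij)).
rewrite dot_Hhat.
have := form_bound u; rewrite ler_norml => /andP[_ h].
have h2 : dot (H u + a *: L (L u)) u <= dot ((lam J + a * gap S j) *: u) u.
  apply: (dot_le ndot cpl) => k Sk.
  rewrite dotDr !dotZr !coord_inv_sqrt_T // (coord_eigen saH) //.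
  have -> : (lam k * coord k u + a * (rho k * (rho k * coord k u))) * coord k u
    = (lam k + a * rho k ^+ 2) * coord k u ^+ 2 by ring.
  rewrite -mulrA -expr2.
  case: (pselect (exists2 l, (l < j)%N & k = inl l)) => [[l lj ->]|nk].
    by rewrite upsi // expr0n !mulr0.
  rewrite ler_wpM2r ?sqr_ge0 //; have [->|kJ] := eqVneq k J.
    by rewrite sqr_rhoJ.
  have lk : lam k <= lam J.
    apply: eigval_le_tail => // l lj.
    by apply/eqP => kl; apply: nk; exists l.
  rewrite sqr_rho // ler0_norm ?subr_le0 // opprB.
  have : 0 <= a * gap S j by rewrite mulr_ge0 // ltW.
  have : a * (lam J - lam k) <= 1 * (lam J - lam k).
    by rewrite ler_wpM2r ?subr_ge0.
  lra.
rewrite dotDl !dotZl in h2; lra.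
Qed.

(** The component of psihat_j orthogonal to psi_j is first bounded through its
    own equation, then compared with the first-order term through the same
    equation rearranged around lambda_j. *)
Lemma remainder_le :
  0 <= dot psihat (psi J) ->
  `|psihat - psi J - first_order Hhat S j| <=
    9 * a *
      ((Num.sqrt (gap S j))^-1 * `|sqrt_absR S j (E (psi J))|).
Proof.
set t := dot psihat (psi J) => t0.
set f := first_order Hhat S j.
have [w wE] : exists w, w = psihat - t *: psi J by exists (psihat - t *: psi J).
pose y := sqrt_absR S j (E w); set x := sqrt_absR S j (E (psi J)).
set s := Num.sqrt (gap S j); set b := s^-1 * `|x|.
have s0 : 0 < s by rewrite sqrtr_gt0.
have s2 : s ^+ 2 = gap S j by rewrite sqr_sqrtr // ltW.
have xE : `|x| = s * b by rewrite /b mulrA mulfV ?mul1r // gt_eqF.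
have b0 : 0 <= b by rewrite mulr_ge0 // invr_ge0 ltW.
clearbody b.
pose d := lamhat - lam J.
have dl : - (a * gap S j) <= d by have := eigval_pert_ge; rewrite /d; lra.
have du : d <= a * gap S j by have := eigval_pert_le; rewrite /d; lra.
have wJ : coord J w = 0.
  by rewrite wE dotBr dotZr on // eqxx mulr1 dotC subrr.
(* The eigenvalue equation of psihat, read in the coordinates off j. *)
have wk k : eigidx S k -> k != J ->
    (lamhat - lam k) * coord k w = t * coord k (E (psi J)) + coord k (E w).
  move=> Sk kJ.
  have psihatE : psihat = t *: psi J + w by rewrite wE addrC subrK.
  have -> : coord k w = coord k psihat.
    by rewrite psihatE dotDr dotZr on // (negPf kJ) mulr0 add0r.
  rewrite -(dotZr dot t) -dotDr -pertZ -pertD -psihatE.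
  by rewrite /pert /= dotBr eigvecP // (coord_eigen saH) // dotZr mulrBl.
have yL : `|y| <= a * `|L w| := le_trans (sqrt_absR_le _) (alphaP _).
have xa : b <= a.
  rewrite -(ler_pM2l s0) -xE mulrC /s -norm_inv_sqrt_T_psiJ.
  exact: le_trans (sqrt_absR_le _) (alphaP _).
have nE : `|psihat| = 1 by exact: eigvec_norm.
have nJ : `|psi J| = 1 by exact: eigvec_norm.
have tw : t ^+ 2 + `|w| ^+ 2 = 1.
  have <- : `|psihat| ^+ 2 = 1 by rewrite nE expr1n.
  rewrite -!(dotxx ndot) wE dotBl !dotBr !dotZl !dotZr (dotC dot (psi J)) -/t.
  by rewrite (dotxx ndot (psi J)) nJ; ring.
have t1 : t <= 1.
  rewrite -ler_sqr ?nnegrE // expr1n.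
  by have := sqr_ge0 `|w|; lra.
(* 4/3 bounds rho_k^2 / |lamhat - lam k|: the shift |d| is at most gap / 4. *)
have Lw : `|L w| <= 4 / 3 * `|t *: x + y|.
  apply: (norm_le ndot cpl) => [|k Sk]; first by lra.
  rewrite coord_inv_sqrt_T // dotDr dotZr !coord_sqrt_absR //.
  case: (eqVneq k J) => [->|kJ].
    by rewrite wJ mulr0 normr0 mulr_ge0 //; lra.
  have r0 := rho_gt0 Sk.
  have -> : t * ((rho k)^-1 * coord k (E (psi J))) + (rho k)^-1 * coord k (E w)
     = (rho k)^-1 * ((lamhat - lam k) * coord k w) by rewrite wk //; ring.
  rewrite !normrM normfV (gtr0_norm r0) !mulrA ler_wpM2r //.
  rewrite mulrAC ler_pdivlMr // -expr2 (sqr_rho kJ).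
  have gk := gap_le Sk kJ.
  have ag : a * gap S j <= 1 / 4 * gap S j by rewrite ler_wpM2r // ltW.
  suff : 3 / 4 * `|lam k - lam J| <= `|lamhat - lam k| by lra.
  have -> : lamhat - lam k = d - (lam k - lam J) by rewrite /d; ring.
  have : `|d| <= a * gap S j by rewrite ler_norml dl.
  have := lerB_dist (lam k - lam J) d; rewrite (distrC d); lra.
have nxy : `|t *: x + y| <= `|x| + a * `|L w|.
  apply: (le_trans (ler_normD _ _)); apply: lerD => //.
  by rewrite normrZ ger0_norm // ler_piMl.
(* |L w| occurs on both sides: absorb 4/3 * a <= 1/3 of it on the left. *)
have Lw2 : `|L w| <= 2 * `|x|.
  have : a * `|L w| <= 1 / 4 * `|L w| by rewrite ler_wpM2r.
  lra.
have wb : `|w| <= 2 * b.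
  rewrite -(ler_pM2l s0); apply: (le_trans (norm_le_inv_sqrt_T _)).
  by apply: (le_trans Lw2); rewrite xE; lra.
have ys : `|y| <= 2 * a * (s * b).
  by apply: (le_trans yL); rewrite -xE -mulrA mulrCA ler_wpM2l.
(* Division by rho_k >= s turns the rearranged equation for
   (lam J - lam k) (w - f)_k into a bound by the three small terms. *)
have off : s * `|w - f| <= `|(t - 1) *: x + y - d *: sqrt_absR S j w|.
  rewrite mulrC -ler_pdivlMr // mulrC; apply: (norm_le ndot cpl) => [|k Sk].
    by rewrite invr_ge0 ltW.
  rewrite dotBr coord_first_order //.
  rewrite [coord k (_ - d *: _)]dotBr [coord k (_ + y)]dotDr !dotZr.
  rewrite !coord_sqrt_absR //.
  case: (eqVneq k J) => [->|kJ].
    by rewrite wJ subrr normr0 mulr_ge0 // invr_ge0 ltW.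
  have r0 := rho_gt0 Sk.
  have kl : lam J - lam k != 0.
    by rewrite -normr_gt0 distrC (lt_le_trans gap_gt0) // gap_le.
  have -> : (t - 1) * ((rho k)^-1 * coord k (E (psi J))) +
      (rho k)^-1 * coord k (E w) - d * ((rho k)^-1 * coord k w)
    = (rho k)^-1 * (lam J - lam k) *
        (coord k w - coord k (E (psi J)) / (lam J - lam k)).
    have -> : coord k (E w) =
        (lamhat - lam k) * coord k w - t * coord k (E (psi J)).
      by rewrite wk //; ring.
    by rewrite /d; field; rewrite kl gt_eqF.
  rewrite normrM mulrA ler_peMl // normrM normfV (gtr0_norm r0).
  rewrite distrC -sqr_rho // expr2 mulKf ?gt_eqF //.
  by rewrite mulrC ler_pdivlMr // mul1r rho_ge.
have Rw : `|d *: sqrt_absR S j w| <= 2 * a * (s * b).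
  rewrite normrZ; have : `|d| <= a * gap S j by rewrite ler_norml dl.
  move=> dn; apply: (le_trans (ler_wpM2r _ dn)) => //.
  have h : s * `|sqrt_absR S j w| <= 2 * b.
    exact: le_trans (norm_sqrt_absR _) wb.
  rewrite -s2 (_ : a * _ * _ = a * s * (s * `|sqrt_absR S j w|)); last by ring.
  rewrite (_ : 2 * a * _ = a * s * (2 * b)); last by ring.
  by apply: ler_wpM2l => //; rewrite mulr_ge0 // ltW.
(* 1 - t <= 1 - t^2 because t lies in [0, 1]. *)
have tb : 1 - t <= 4 * (b * b).
  have : `|w| ^+ 2 <= (2 * b) ^+ 2 by rewrite ler_sqr ?nnegrE // mulr_ge0.
  nra.
have ab0 : 0 <= a * b by exact: mulr_ge0.
have bb : b * b <= a * b by rewrite ler_wpM2r.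
have bbb : b * b * b <= 1 / 4 * (a * b).
  apply: (@le_trans _ _ (b * (a * b))); first by rewrite -mulrA ler_wpM2l.
  by rewrite ler_wpM2r // (le_trans xa).
have wf : `|w - f| <= 5 * (a * b).
  rewrite -(ler_pM2l s0); apply: (le_trans off).
  apply: (le_trans (ler_normB _ _)).
  apply: (le_trans (lerD (ler_normD _ _) Rw)).
  rewrite normrZ distrC ger0_norm ?subr_ge0 // xE.
  have : (1 - t) * (s * b) <= s * (a * b).
    rewrite mulrCA ler_wpM2l ?(ltW s0) //.
    have : (1 - t) * b <= 4 * (b * b) * b by rewrite ler_wpM2r.
    lra.
  lra.
have -> : psihat - psi J - f = (t - 1) *: psi J + (w - f).
  rewrite wE scalerBl scale1r !addrA; congr (_ - _).
  by rewrite -addrA [RHS]addrC addrA subrK.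
apply: (le_trans (ler_normD _ _)).
rewrite normrZ nJ mulr1 distrC ger0_norm ?subr_ge0 //.
lra.
Qed.

End Bound.
End Perturbation.

Theorem theorem3p8 (R : realType) (V : completeNormedModType R)
    (dot : {dot V for @idfun R}) (H Hhat : {linear V -> V})
    (S : eigensystem dot H) (Shat : eigensystem dot Hhat) (j : nat) :
  norm_of_dot dot -> separable V ->
  compact_operator H -> self_adjoint dot H -> nonneg_eigenvalues H ->
  compact_operator Hhat -> self_adjoint dot Hhat -> nonneg_eigenvalues Hhat ->
  eigidx S (inl j) -> eigidx Shat (inl j) ->
  0 < gap S j ->
  (alpha Hhat S j <= (1 / 4)%:E)%E ->
  0 <= dot (eigvec Shat (inl j)) (eigvec S (inl j)) ->
  (`|eigvec Shat (inl j) - eigvec S (inl j) - first_order Hhat S j|%:E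
    <= (164 / 9)%:E * alpha Hhat S j * beta Hhat S j)%E.
Proof.
move=> ndot _ _ saH _ _ saHhat _ Sj Shatj gap0 alpha_le overlap.
have [a aE [a0 a4 aP]] := alpha_fin ndot Sj gap0 alpha_le.
have := remainder_le ndot saH saHhat Sj Shatj gap0 a0 a4 aP overlap.
rewrite -lee_fin aE => /le_trans; apply.
set b := _ * `|_|; have b0 : 0 <= b by rewrite mulr_ge0 // invr_ge0 sqrtr_ge0.
apply: (@le_trans _ _ (164 / 9 * a * b)%:E).
  have : 0 <= a * b by exact: mulr_ge0.
  by rewrite lee_fin; lra.
rewrite -EFinM [leLHS]EFinM; apply: lee_wpmul2l; last exact: beta_ge.
by rewrite lee_fin !mulr_ge0.
Qed.
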